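(* There exist a set $G$ of irrational real numbers greater than $1$ and a constant $c>0$ such that \[ G(x) = |\{g\in G : g\le x\}| > c\,\frac{x}{\log x} \] for all sufficiently large $x$, and such that the Beurling integers $b_0=1\le b_1\le b_2\le\dots$ generated by $G$ satisfy $b_{i+1}-b_i\ge 1$ for all $i$.
   Context: For a sequence $G=\{g_1,g_2,\dots\}$ of real numbers with $1<g_1\le g_2\le\dots$ (the generators), the associated Beurling integers are the sequence $B=\{b_0,b_1,b_2,\dots\}$, $b_0=1\le b_1\le b_2\le\dots$, consisting of all finite products of elements of $G$ (repetitions of factors allowed, the empty product being $1$), listed in nondecreasing order with multiplicity. *)

(* Defs.v *)
From HB Require Import structures.
From mathcomp Require Import all_boot all_order all_algebra finmap multiset.
From mathcomp Require Import all_classical all_reals all_analysis.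
Set Implicit Arguments.
Unset Strict Implicit.
Unset Printing Implicit Defensive.
Import Order.TTheory GRing.Theory Num.Theory.
Import numFieldNormedType.Exports.
Local Open Scope classical_set_scope.
Local Open Scope ring_scope.

(* [fset_set] sends an infinite set to the empty [{fset R}], so a positive
   lower bound on [gen_count G x] also says that G has only finitely many
   elements up to x. *)
Definition gen_count (R : realType) (G : set R) (x : R) : nat :=
  #|` fset_set [set g | G g /\ g <= x]|%fset.

(* A finite product of elements of G, with repetitions allowed and the order of
   the factors disregarded, is a finite multiset supported in G. *)
Definition gen_multisets (R : realType) (G : set R) : set {mset R}%mset :=
  [set m | forall g : R, g \in m -> G g].

(* The sequence b lists the products of all multisets over G in nondecreasing
   order; since e is a bijection between indices and multisets, a real number
   occurs in b as often as it has factorizations over G.  When the elements of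
   G exceed 1, there is at most one such b, and b 0 = 1. *)
Definition beurling_integers (R : realType) (G : set R) (b : nat -> R) : Prop :=
  (forall i : nat, b i <= b i.+1) /\
  exists e : nat -> {mset R}%mset,
    set_bij [set: nat] (gen_multisets G) e /\
    forall i : nat, b i = \prod_(g <- e i) g.

(* Main.v *)
Require Import Defs.
From mathcomp Require Import all_boot all_order all_algebra finmap multiset.
From mathcomp Require Import fingroup cyclic.
From mathcomp Require Import all_classical all_reals all_analysis.
From mathcomp Require Import zify lra.
Set Implicit Arguments.
Unset Strict Implicit.
Unset Printing Implicit Defensive.
Import Order.TTheory GRing.Theory Num.Theory.
Import numFieldNormedType.Exports.

(** If x = a + b sqrt 2 and y = c + d sqrt 2 are distinct and their conjugates
    differ by at most 1 in absolute value, then |x - y| >= 1, because the norm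
    of x - y is a nonzero integer.  So any multiplicatively free set of
    elements of Z[sqrt 2] greater than 2 whose conjugates are less than 1/2 in
    absolute value generates Beurling integers with gaps at least 1.

    Let p be a prime congruent to 1 or 7 modulo 8.  Then 2 is a square modulo
    p, and the pigeonhole principle gives such an element g of norm p or 2p up
    to sign, with p < g < 8p.  Since p is odd, the multiplicity of the
    generator attached to p in a product is the p-adic valuation of the norm
    of that product, whence freeness.

    There are at least c x / log x such primes up to x: if chi is the quadratic
    character of conductor 8, Mertens' argument shows that the sum of
    (1 + chi p) log p / p over the primes p <= x is log x + O(1), and one
    compares x with x / D for a large constant D. *)

(** * Chebyshev's upper bound *)

Lemma prod_primes_dvdn (m n X : nat) :
  (forall p, m <= p < n -> prime p -> p %| X) ->
  \prod_(m <= p < n | prime p) p %| X.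
Proof.
move=> h; rewrite big_mkcond /=; elim: n h => [|n IHn] h; first by rewrite big_geq.
have [lemn|ltnm] := leqP m n; last by rewrite big_geq.
have {}IHn : \prod_(m <= i < n) (if prime i then i else 1) %| X.
  by apply: IHn => p /andP[mp pn]; apply: h; rewrite mp ltnW.
rewrite big_nat_recr //=; case: ifP => pn; last by rewrite muln1.
rewrite Gauss_dvd ?IHn /=; first by apply: h; rewrite ?lemn /=.
rewrite big_nat; apply: (big_ind (fun x => coprime x n)) => [|x y cx cy|i /andP[_ ltin]].
- exact: coprime1n.
- by rewrite coprimeMl cx cy.
case: ifP => pi; last exact: coprime1n.
rewrite prime_coprime // dvdn_prime2 //; apply/eqP; lia.
Qed.

(** The expansion of [(1 + 1) ^ (2m + 1)] contains this coefficient twice, at [m] and at [m + 1]. *)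
Lemma bin_mid_le (m : nat) : 'C(m.*2.+1, m) <= 4 ^ m.
Proof.
have : 'C(m.*2.+1, m) + 'C(m.*2.+1, m.+1) <= 2 ^ m.*2.+1.
  rewrite -[2]/(1 + 1) expnDn.
  have lem : m < m.*2.+2 by lia.
  have lem1 : m.+1 < m.*2.+2 by lia.
  rewrite (bigD1 (Ordinal lem)) //= (bigD1 (Ordinal lem1)) //=; last first.
    by apply/eqP => -[]; lia.
  by rewrite !exp1n !muln1; lia.
have -> : 'C(m.*2.+1, m.+1) = 'C(m.*2.+1, m).
  by rewrite -bin_sub; [congr 'C(_, _); lia|lia].
rewrite expnS -muln2 mulnC expnM -[2 ^ 2]/4; lia.
Qed.

Lemma prime_dvd_fact (p n : nat) : prime p -> (p %| n`!) -> p <= n.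
Proof.
move=> pp; elim: n => [|n IHn]; first by rewrite dvdn1 => /eqP p1; rewrite p1 in pp.
rewrite factS Euclid_dvdM // => /orP[/dvdn_leq|/IHn]; lia.
Qed.

(** Erdős's induction. For [n = 2m + 1] the primes from [m + 2] to [n] divide ['C(2m + 1, m)], and
    those up to [m + 1] fall under the induction hypothesis; an even [n > 2] is not prime. *)
Lemma primorial_le (n : nat) : \prod_(1 <= p < n.+1 | prime p) p <= 4 ^ n.
Proof.
elim/ltn_ind: n => n IHn.
case: (leqP n 2) => [|n_gt2].
  by case: n {IHn} => [|[|[|//]]] _; rewrite big_mkcond unlock.
have := odd_double_half n; set m := n./2; case: (boolP (odd n)) => on /= En.
  have lt1 : m.+1 < n by lia.
  rewrite (@big_cat_nat _ _ _ m.+2) //=; last by lia.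
  have -> : 4 ^ n = 4 ^ m.+1 * 4 ^ m by rewrite -expnD; congr (_ ^ _); lia.
  apply: leq_mul; first exact: IHn.
  apply: leq_trans (bin_mid_le m); apply: dvdn_leq.
    by rewrite bin_gt0; lia.
  apply: prod_primes_dvdn => p /andP[mp pn] pp.
  have: p %| 'C(m.*2.+1, m) * (m`! * (m.*2.+1 - m)`!).
    rewrite bin_fact; last by lia.
    by apply: dvdn_fact; apply/andP; split; lia.
  rewrite !Euclid_dvdM // => /or3P[//| |] /(prime_dvd_fact pp) {IHn}; lia.
have nE : n = n.-1.+1 by lia.
have np : prime n = false by apply/negP => /even_prime; lia.
rewrite big_mkcond /= nE big_nat_recr -?nE /=; last by lia.
rewrite np muln1 -big_mkcond /=.
have {1}-> : n = n.-1.+1 by lia.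
apply: leq_trans (IHn n.-1 _) _; [by lia|by rewrite leq_exp2l; lia].
Qed.

Local Open Scope ring_scope.

(** * The quadratic character of 2 *)

(* In F, [(-1)^k k] equals [k] for even k and [p - k] for odd k; for
   [1 <= k <= m] these are exactly the even numbers from 2 to [p - 1]. *)
Lemma gauss_prod_even (F : comNzRingType) (p m : nat) : (p%:R = 0 :> F) ->
  p = m.*2.+1 ->
  \prod_(i < m) (2 * i.+1)%:R = \prod_(i < m) ((-1) ^+ i.+1 * (i.+1)%:R) :> F.
Proof.
case: m => [|m] p0 pE; first by rewrite !big_ord0.
pose h (i : 'I_m.+1) : 'I_m.+1 := inord (if odd i then i./2 else (m - i./2)%N).
have hE i : nat_of_ord (h i) = (if odd i then i./2 else (m - i./2)%N).
  by rewrite inordK //; case: ifP; have := ltn_ord i; lia.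
have h_inj : injective h.
  move=> i j /(congr1 (@nat_of_ord _)); rewrite !hE => hij; apply: val_inj => /=.
  by have := ltn_ord i; have := ltn_ord j; move: hij; do 2 case: ifP; lia.
rewrite (reindex_inj h_inj) /=; apply: eq_bigr => i _; rewrite hE -signr_odd /=.
have := ltn_ord i; case: (boolP (odd i)) => oi lti /=.
  by rewrite expr0 mul1r; congr (_%:R); lia.
rewrite expr1 mulN1r; apply/eqP; rewrite -addr_eq0 -natrD -p0; apply/eqP.
by congr (_%:R); lia.
Qed.

(** Four consecutive signs multiply to 1. The residue of [p] makes [m] congruent to 0 or 3 modulo 4,
    and three leftover signs -, +, - also multiply to 1. *)
Lemma sign_prod (F : nzRingType) (p m : nat) :
  p = m.*2.+1 -> ((p %% 8 = 1)%N \/ (p %% 8 = 7)%N) -> \prod_(i < m) ((-1) ^+ i.+1) = 1 :> F.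
Proof.
move=> pE hp; have [k mE] : exists k, (m = 4 * k \/ m = (4 * k).+3)%N.
  by exists (m %/ 4)%N; lia.
have s4 j : (-1) ^+ (4 * j) = 1 :> F by rewrite -signr_odd oddM.
have h j : \prod_(i < 4 * j) (-1) ^+ i.+1 = 1 :> F.
  elim: j => [|j IHj]; first by rewrite big_ord0.
  have -> : (4 * j.+1 = (4 * j).+4)%N by lia.
  rewrite !big_ord_recr /= IHj !exprS s4.
  by rewrite !(mulrN, mulNr, mulr1, mul1r, opprK).
case: mE => ->; first exact: h.
rewrite !big_ord_recr /= h !exprS s4.
by rewrite !(mulrN, mulNr, mulr1, mul1r, opprK).
Qed.

(** One direction of Euler's criterion: the units form a cyclic group of order [2m], so [x = g ^ k]
    and [x ^ m = 1] force [k] to be even. *)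
Lemma euler_square (p m : nat) (x : 'F_p) : prime p ->  p = m.*2.+1 ->
  x ^+ m = 1 -> exists y, x = y ^+ 2.
Proof.
move=> pp pE xm.
have m0 : (0 < m)%N by case: m pE {xm} => // p1; move: pp; rewrite {1}p1.
have x0 : x != 0.
  by apply/eqP => x0; move: xm; rewrite x0 expr0n gtn_eqF // => /esym/eqP; rewrite oner_eq0.
have /cyclicP[g gE] := field_unit_group_cyclic [set: {unit 'F_p}]%G.
have ux : x \is a GRing.unit by rewrite unitfE.
have /cycleP[k kE] : FinRing.unit 'F_p ux \in <[g]>%g by rewrite -gE inE.
have og : #[g]%g = m.*2.
  rewrite orderE -gE.
  have -> : #|[set: {unit 'F_p}]| = #|predC1 (0 : 'F_p)|.
    by rewrite cardsT card_sub; apply: eq_card => y; rewrite !inE unitfE.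
  by rewrite cardC1 card_Fp // {1}pE.
have : (g ^+ (k * m) == 1)%g.
  by rewrite expgM -kE -val_eqE /= FinRing.val_unitX /= xm.
rewrite -order_dvdn og -muln2 mulnC dvdn_pmul2r // => /dvdnP[j jE].
exists (val g ^+ j).
have := congr1 val kE; rewrite /= FinRing.val_unitX jE exprM => ->//.
Qed.

Lemma two_square_mod (p : nat) : prime p -> ((p %% 8 = 1)%N \/ (p %% 8 = 7)%N) ->
  exists s : nat, s ^ 2 = 2 %[mod p].
Proof.
move=> pp hp; pose m := p./2.
have pE : p = m.*2.+1 by rewrite /m; lia.
have p0 : p%:R = 0 :> 'F_p by exact: pchar_Fp_0.
(* Both products in [gauss_prod_even] contain the factor [m!], nonzero modulo [p]; cancelling it
   leaves [2 ^ m] equal to the product of the signs. *)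
have h : 2%:R ^+ m = 1 :> 'F_p.
  have := gauss_prod_even p0 pE; rewrite big_split /= (sign_prod _ pE hp) mul1r.
  under eq_bigr do rewrite natrM.
  rewrite big_split /= prodr_const card_ord.
  set P := \prod_(i < m) _ => PE.
  have P0 : P != 0.
    apply/prodf_neq0 => i _; rewrite -(dvdn_pcharf (pchar_Fp pp)).
    by apply/negP => /dvdn_leq; have := ltn_ord i; lia.
  by apply: (mulIf P0); rewrite PE mul1r.
have [y yE] := euler_square pp pE h.
exists (val y); rewrite -!val_Fp_nat // natrX; congr val.
by rewrite yE; congr (_ ^+ _); rewrite natr_Zp.
Qed.

(** * Elements of Z[sqrt 2] with small conjugate *)

(** For nonzero [b] the 2-adic valuation would be even on the left and odd on the right. *)
Lemma sqr_eq_double_sqr (a b : int) : a ^+ 2 = 2 * b ^+ 2 -> b = 0.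
Proof.
move=> /(congr1 absz); rewrite abszM !abszX => h.
apply/eqP; rewrite -absz_eq0; apply/eqP; case: (posnP `|b|%N) => // b0.
have a0 : (0 < `|a|)%N by case: (posnP `|a|%N) h => // ->; lia.
have := congr1 (logn 2) h; rewrite lognM ?expn_gt0 ?b0 // !lognX (_ : logn 2 `|2|%N = 1%N) //; lia.
Qed.

Section Sqrt2.
Variable R : realType.
Local Notation r2 := (Num.sqrt 2 : R).

Lemma sqr_sqrt2 : r2 * r2 = 2. Proof. by rewrite -expr2 sqr_sqrtr. Qed.

Lemma sqrt2_gt : 7 / 5 < r2.
Proof.
have := sqr_sqrt2; have : 0 <= r2 by exact: sqrtr_ge0.
by move=> ? ?; rewrite ltNge; apply/negP => ?; nra.
Qed.

Lemma sqrt2_lt : r2 < 17 / 12.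
Proof.
have := sqr_sqrt2; have : 0 <= r2 by exact: sqrtr_ge0.
by move=> ? ?; rewrite ltNge; apply/negP => ?; nra.
Qed.

Lemma quad_norm (a b : int) :
  (a%:~R + b%:~R * r2) * (a%:~R - b%:~R * r2) = (a ^+ 2 - 2 * b ^+ 2)%:~R :> R.
Proof.
rewrite !expr2 rmorphB !rmorphM /=; have := sqr_sqrt2 => h.
by rewrite -[2%:~R]h; lra.
Qed.

Lemma quad_eq0 (a b : int) : a%:~R + b%:~R * r2 = 0 -> a = 0 /\ b = 0.
Proof.
move=> h; have := quad_norm a b; rewrite h mul0r => /esym/eqP.
rewrite intr_eq0 subr_eq0 => /eqP/sqr_eq_double_sqr b0; split => //.
by move: h; rewrite b0 mul0r addr0 => /eqP; rewrite intr_eq0 => /eqP.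
Qed.

Lemma quad_gap (a b : int) : a%:~R + b%:~R * r2 != 0 ->
  `|a%:~R - b%:~R * r2| <= 1 -> 1 <= `|a%:~R + b%:~R * r2|.
Proof.
move=> x0 y1; have : 1 <= `|(a ^+ 2 - 2 * b ^+ 2)%:~R : R|.
  rewrite norm_intr_ge1 // intr_eq0; apply/eqP => N0; have := quad_norm a b.
  rewrite N0 => /eqP; rewrite mulf_eq0 (negPf x0) /= => /eqP y0.
  have [|a0 /eqP] := @quad_eq0 a (- b); first by rewrite rmorphN mulNr.
  by rewrite oppr_eq0 => /eqP b0; move: x0; rewrite a0 b0 mul0r addr0 eqxx.
rewrite -quad_norm normrM => /le_trans; apply.
by rewrite ler_piMr.
Qed.

(** Here [n] is the absolute norm of [x]. The pair [a], [b] is unique by the irrationality of [r2],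
    so [n] is determined by [x]. The bound 1/2 survives products and keeps the conjugates of two
    such elements within distance 1. *)
Definition quad_rep (x : R) (n : nat) := exists a b : int,
  [/\ x = a%:~R + b%:~R * r2, `|a%:~R - b%:~R * r2| < 1 / 2
    & absz (a ^+ 2 - 2 * b ^+ 2)%R = n].

Lemma quad_rep_mul x y m n : quad_rep x m -> quad_rep y n -> quad_rep (x * y) (m * n).
Proof.
move=> [a [b [-> ab abn]]] [c [d [-> cd cdn]]].
exists (a * c + 2 * (b * d)), (a * d + b * c).
(* Stated for any square root [t] of 2, to serve at [r2] for the product and at [- r2] for its
   conjugate. *)
have e t : t * t = 2 -> (a * c + 2 * (b * d))%:~R + (a * d + b * c)%:~R * t
   = (a%:~R + b%:~R * t) * (c%:~R + d%:~R * t) :> R.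
  by move=> t2; rewrite 2!rmorphD !rmorphM /= -[2%:~R]t2; lra.
split; first by rewrite e // sqr_sqrt2.
  have := e (- r2); rewrite !mulrN mulNr opprK sqr_sqrt2 => -> //.
  by rewrite normrM; move: (normr_ge0 (a%:~R - b%:~R * r2)) (normr_ge0 (c%:~R - d%:~R * r2)); nra.
by rewrite -abn -cdn -abszM; congr absz; lra.
Qed.

Lemma quad_rep_inj x m n : quad_rep x m -> quad_rep x n -> m = n.
Proof.
move=> [a [b [-> _ <-]]] [c [d [/eqP]]]; rewrite -subr_eq0 => /eqP h _ <-.
have [] := @quad_eq0 (a - c) (b - d); last by move=> /subr0_eq -> /subr0_eq ->.
by rewrite !rmorphB /= -h; lra.
Qed.

Lemma quad_rep_gap x y m n : quad_rep x m -> quad_rep y n -> x != y -> 1 <= `|x - y|.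
Proof.
move=> [a [b [-> ab _]]] [c [d [-> cd _]]]; rewrite -subr_eq0.
have e t : (a%:~R + b%:~R * t - (c%:~R + d%:~R * t)) = (a - c)%:~R + (b - d)%:~R * t :> R.
  by rewrite !rmorphB /=; lra.
rewrite e => h; apply: quad_gap => //.
have := e (- r2); rewrite !mulrN => <-.
by rewrite (le_trans (ler_normB _ _)) //; lra.
Qed.

(** If [b = 0], then [x] equals its conjugate, which is below 1/2. Otherwise a rational value gives
    a nontrivial integer relation between 1 and [r2]. *)
Lemma quad_rep_irrational x m : quad_rep x m -> 1 <= x -> irrational x.
Proof.
move=> [a [b [-> ab _]]] x1 [q _ qE].
have b0 : b != 0.
  apply/eqP => b0; move: ab x1; rewrite b0 !mul0r subr0 addr0 => ab x1.
  by move: (ler_norm (a%:~R : R)); lra.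
have dE := divq_num_den q.
have := qE; rewrite -[in LHS]dE rmorph_div ?unitfE ?intr_eq0 ?denq_eq0 //= !ratr_int.
move/(canRL (mulfVK _)); rewrite intr_eq0 denq_eq0 => /(_ isT) h.
have [] := @quad_eq0 (denq q * a - numq q) (denq q * b).
  by rewrite !(rmorphB, rmorphM) /= h; lra.
by move=> _ /eqP; rewrite mulf_eq0 (negPf b0) denq_eq0.
Qed.

Lemma generator_exists (p : nat) : prime p -> ((p %% 8 = 1)%N \/ (p %% 8 = 7)%N) ->
  exists (x : R) (n : nat), [/\ quad_rep x n, n = p \/ n = (2 * p)%N & p%:R < x < (8 * p)%:R].
Proof.
move=> pp hp; have [s sE] := two_square_mod pp hp.
have p7 : (7 <= p)%N by have := prime_gt1 pp; lia.
pose f (b : nat) : int := Num.floor (b%:R * r2).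
have fb b : (f b)%:~R <= b%:R * r2 < (f b)%:~R + 1 by have := floor_itv (b%:R * r2); rewrite intrD.
(* Two of the p + 1 values of [F] agree, so some [a + b sqrt 2] with conjugate
   less than 1 and [0 < b <= p] has norm divisible by p. *)
pose F (b : 'I_p.+1) : 'F_p := (f b)%:~R - s%:R * b%:R.
have [b1 [b2 [lb Fb]]] : exists b1 b2 : 'I_p.+1, (b1 < b2)%N /\ F b1 = F b2.
  have /injectivePn[b1 [b2 neqb Fb]] : ~~ injectiveb F.
    apply/negP => /injectiveP/leq_card; rewrite card_ord card_Fp //; lia.
  have /orP[lb|lb] : (b1 < b2)%N || (b2 < b1)%N.
  - by rewrite -neq_ltn; apply: contraNneq neqb => /val_inj ->.
  - by exists b1, b2.
  - by exists b2, b1.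
pose a := f b2 - f b1; pose b : nat := (b2 - b1)%N.
have bp : (0 < b <= p)%N by rewrite /b; have := ltn_ord b2; lia.
have bE : b%:R = b2%:R - b1%:R :> R by rewrite natrB // ltnW.
have ab : -1 < a%:~R - b%:R * r2 < 1.
  by rewrite /a rmorphB /= bE mulrBl; have := fb b1; have := fb b2; lra.
(* Equal values of [F] mean [a = s b] modulo [p], and [s ^ 2 = 2] there. *)
have pN : (p %| absz (a ^+ 2 - 2 * b%:Z ^+ 2)%R)%N.
  have ab0 : a%:~R = s%:R * b%:R :> 'F_p.
    rewrite /a rmorphB /= natrB 1?ltnW // mulrBr; move: Fb; rewrite /F => Fb.
    rewrite -[X in X - _](subrK (s%:R * b2%:R)) -Fb.
    by rewrite [X in X + _ - _]addrC addrAC addrK addrC.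
  have s2 : s%:R ^+ 2 = 2 :> 'F_p.
    by rewrite -natrX -(Fp_nat_mod pp) sE Fp_nat_mod.
  have : (a ^+ 2 - 2 * b%:Z ^+ 2)%:~R = 0 :> 'F_p.
    by rewrite !expr2 rmorphB !rmorphM /= ab0 -[2%:~R]s2 -expr2 exprMn -expr2 subrr.
  rewrite [X in X%:~R]intEsign rmorphM rmorph_sign /= => /eqP.
  by rewrite mulf_eq0 signr_eq0 /= -(dvdn_pcharf (pchar_Fp pp)).
clearbody a b => {F f fb Fb lb b1 b2 bE}.
have br : (1 <= b%:R :> R) && (b%:R <= p%:R :> R) by rewrite ler1n ler_nat.
have p7r : 7 <= p%:R :> R by rewrite (ler_nat _ 7).
have := sqrt2_gt; have := sqrt2_lt; have := sqr_sqrt2 => r22 r2lt r2gt.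
have nE := quad_norm a b.
set N := a ^+ 2 - 2 * b%:Z ^+ 2 in nE pN.
(* The element is its conjugate, less than 1, plus [2 b r2], at most [17 p / 6]; as [p >= 7], this
   stays below [3 p]. *)
have ab1 : 0 < a%:~R + b%:R * r2 < 3 * p%:R by apply/andP; split; nra.
have N0 : N != 0.
  rewrite -(intr_eq0 R) -nE; apply: mulf_neq0; first by rewrite gt_eqF //; case/andP: ab1.
  apply/eqP => h; have := @quad_eq0 a (- b%:Z); rewrite rmorphN /= mulNr.
  by move=> /(_ h)[_ /eqP]; rewrite oppr_eq0 => /eqP[b0]; move: bp; rewrite b0.
have N3 : (`|N| < 3 * p)%N.
  rewrite -(ltr_nat R) natr_absz intr_norm -nE normrM natrM (gtr0_norm (proj1 (andP ab1))).
  have : `|a%:~R - b%:R * r2| < 1 by rewrite ltr_norml.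
  have := normr_ge0 (a%:~R - b%:R * r2); case/andP: ab1; nra.
have Np : `|N|%N = p \/ `|N|%N = (2 * p)%N.
  case/dvdnP: pN N3 (N0) => k kE; rewrite -absz_eq0 kE {N0 nE ab1}.
  rewrite ltn_pmul2r ?prime_gt0 //; case: k {kE} => [|[|[|//]]]; rewrite ?mul1n ?mul0n //.
  - by left.
  - by right.
(* Multiplication by the unit [1 + sqrt 2] brings the conjugate below 1/2. *)
pose A := a + 2 * b%:Z; pose B := a + b%:Z.
have AB t : t * t = 2 -> A%:~R + B%:~R * t = (a%:~R + b%:R * t) * (1 + t) :> R.
  by move=> t2; rewrite /A /B 2!rmorphD !rmorphM /= -[2%:~R]t2; lra.
have NE : A ^+ 2 - 2 * B ^+ 2 = - N by rewrite /A /B /N; lra.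
have conjAB : `|A%:~R - B%:~R * r2| < 1 / 2.
  have := AB (- r2); rewrite mulrN mulNr opprK !mulrN => -> //.
  rewrite normrM.
  have : `|1 - r2| < 5 / 12 by rewrite ltr_norml; lra.
  have : `|a%:~R - b%:R * r2| < 1 by rewrite ltr_norml.
  have := normr_ge0 (a%:~R - b%:R * r2); have := normr_ge0 (1 - r2); nra.
exists (A%:~R + B%:~R * r2), `|N|%N; split=> //.
  by exists A, B; split => //; rewrite NE abszN.
have xp : 0 < A%:~R + B%:~R * r2 by rewrite AB //; nra.
(* Upper bound: [3 p (1 + 17 / 12) < 8 p]. Lower bound: the norm is at least [p] in absolute value
   and the conjugate is below 1/2. *)
apply/andP; split; last by rewrite AB // natrM; case/andP: ab1; nra.
have : p%:R <= `|N|%:R :> R by rewrite ler_nat; case: Np => -> //; rewrite leq_pmull.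
rewrite natr_absz intr_norm -normrN -rmorphN /= -NE -quad_norm normrM (gtr0_norm xp).
have := normr_ge0 (A%:~R - B%:~R * r2); nra.
Qed.
End Sqrt2.

(** * Primes congruent to 1 or 7 modulo 8 *)

Definition good_prime (p : nat) : bool := prime p && ((p %% 8 == 1) || (p %% 8 == 7))%N.

(** * The character of conductor 8 and its harmonic sum *)

Section Chebyshev.
Variable R : realType.
Implicit Types (n N M p : nat).

(** For prime [p], the weight [1 + chi8 p] is 2 on [good_prime], 0 at the other odd primes and 1 at
    2. *)
Definition chi8 n : R :=
  if ((n %% 8 == 1) || (n %% 8 == 7))%N then 1
  else if ((n %% 8 == 3) || (n %% 8 == 5))%N then -1 else 0.

Lemma chi8M m n : chi8 (m * n) = chi8 m * chi8 n.
Proof.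
rewrite /chi8 -modnMm.
have := ltn_pmod m (isT : (0 < 8)%N); have := ltn_pmod n (isT : (0 < 8)%N).
by case: (m %% 8)%N => [|[|[|[|[|[|[|[|]]]]]]]] //; case: (n %% 8)%N => [|[|[|[|[|[|[|[|]]]]]]]] // _ _ /=;
   rewrite ?(mulr0, mul0r, mulr1, mul1r, mulrN, mulNr, opprK).
Qed.

Lemma normr_chi8_le1 n : `|chi8 n| <= 1.
Proof. by rewrite /chi8; case: ifP => _; [rewrite normr1|case: ifP; rewrite ?normrN ?normr1 ?normr0 ?ler01]. Qed.

Lemma sum_chi8 n : \sum_(0 <= i < n) chi8 i =
  (if (0 < n %% 8 <= 3)%N && (n %% 8 != 1)%N then 1 else if (n %% 8 == 6)%N || (n %% 8 == 7)%N then -1 else 0).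
Proof.
elim: n => [|n IHn]; first by rewrite big_geq.
rewrite big_nat_recr //= IHn /chi8 -(addn1 n) -modnDml.
have := ltn_pmod n (isT : (0 < 8)%N).
by case: (n %% 8)%N => [|[|[|[|[|[|[|[|]]]]]]]] // _; rewrite /= ?(addr0, add0r, subrr, addNr).
Qed.

Lemma normr_sum_chi8 n : `|\sum_(0 <= i < n) chi8 i| <= 1.
Proof.
by rewrite sum_chi8; case: ifP => _; [rewrite normr1|case: ifP; rewrite ?normrN ?normr1 ?normr0 ?ler01].
Qed.

(** Dirichlet's test with an explicit constant: the partial sums of [chi8] stay in [-1, 1], and the
    weights decrease. *)
Lemma chi8_sum_tail (a : nat -> R) m N :
  (forall n, (m <= n)%N -> 0 <= a n) -> (forall n, (m <= n)%N -> a n.+1 <= a n) ->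
  `|\sum_(m <= n < N) chi8 n * a n| <= 2 * a m.
Proof.
move=> a0 ad; have [lemN|ltNm] := leqP m N; last first.
  by rewrite big_geq ?normr0 ?mulr_ge0 ?a0 // ltnW.
pose S n := \sum_(0 <= i < n) chi8 i.
have SS n : S n.+1 = S n + chi8 n by rewrite /S big_nat_recr.
(* Abel summation *)
suff H : `|\sum_(m <= n < N) chi8 n * a n - S N * a N| <= 2 * a m - a N.
  have : `|S N * a N| <= a N.
    by rewrite normrM (ger0_norm (a0 N lemN)); apply: ler_piMl; rewrite ?a0 ?normr_sum_chi8.
  by move: H; rewrite !ler_norml; lra.
elim: N lemN => [|N IHN].
  rewrite leqn0 => /eqP m0; rewrite m0 big_geq // /S big_geq // mul0r subr0 normr0.
  by have := a0 0%N; rewrite m0 => /(_ isT); lra.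
rewrite leq_eqVlt => /orP[/eqP <-|ltmN].
  rewrite big_geq // sub0r normrN normrM (ger0_norm (a0 m (leqnn m))).
  by have := normr_sum_chi8 m; have := a0 m (leqnn m); rewrite -/(S m); nra.
have mN : (m <= N)%N by rewrite -ltnS.
rewrite big_nat_recr //=.
have -> : \sum_(m <= i < N) chi8 i * a i + chi8 N * a N - S N.+1 * a N.+1 =
  (\sum_(m <= i < N) chi8 i * a i - S N * a N) + S N.+1 * (a N - a N.+1).
  by rewrite SS; lra.
apply: le_trans (ler_normD _ _) _.
have : `|S N.+1 * (a N - a N.+1)| <= a N - a N.+1.
  rewrite normrM [X in _ * X]ger0_norm ?subr_ge0 ?ad //.
  by apply: ler_piMl; rewrite ?subr_ge0 ?ad ?normr_sum_chi8.
by have := IHN mN; lra.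
Qed.

(** A partial sum of the Dirichlet series at 1, L(1, chi). *)
Definition chi8_harmonic N : R := \sum_(1 <= n < N.+1) chi8 n * n%:R^-1.

Lemma chi8_harmonic_diff M N : (M <= N)%N ->
  `|chi8_harmonic N - chi8_harmonic M| <= 2 * M.+1%:R^-1.
Proof.
move=> leMN; rewrite /chi8_harmonic (@big_cat_nat _ _ _ M.+1) //= addrAC subrr add0r.
by apply: chi8_sum_tail => n Mn //; rewrite lef_pV2 ?posrE ?ltr0n ?ler_nat //; lia.
Qed.

Lemma chi8_harmonic_le N : `|chi8_harmonic N| <= 2.
Proof.
have := chi8_harmonic_diff (leq0n N); rewrite {2}/chi8_harmonic big_geq // subr0.
by rewrite invr1 mulr1.
Qed.

(** A quantitative form of L(1, chi) being nonzero: the sum up to 2 is 1, and the rest is at most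
    2/3 in absolute value. *)
Lemma chi8_harmonic_ge N : (0 < N)%N -> 1 / 3 <= chi8_harmonic N.
Proof.
case: N => [//|[|N]] _.
  by rewrite /chi8_harmonic big_nat1 /chi8 /= invr1; lra.
have := @chi8_harmonic_diff 2 N.+2 isT.
have -> : chi8_harmonic 2 = 1.
  by rewrite /chi8_harmonic big_nat_recr // big_nat1 /chi8 /= invr1; lra.
by rewrite ler_norml; lra.
Qed.

(** * Mertens' estimates, plain and twisted by the character *)

Lemma ln_nat_ge0 n : (0 <= ln n%:R :> R).
Proof. by case: n => [|n]; [rewrite ln0|rewrite ln_ge0 // ler1n]. Qed.

Lemma ln_le_pred (x : R) : 0 < x -> ln x <= x - 1.
Proof. by move=> x0; have := @le_ln1Dx R (x - 1); rewrite addrCA subrr addr0; apply; lra. Qed.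

Lemma ln_succ_le n : (0 < n)%N -> ln n.+1%:R - ln n%:R <= n%:R^-1 :> R.
Proof.
move=> n0; have n0r : 0 < n%:R :> R by rewrite ltr0n.
rewrite -ln_div ?posrE ?ltr0n //.
apply: le_trans (ln_le_pred _) _; first by rewrite divr_gt0 ?ltr0n.
by rewrite -addn1 natrD mulrDl divff ?gt_eqF // mul1r addrAC subrr add0r.
Qed.

Lemma sum_ln_le N : \sum_(1 <= n < N.+1) ln n%:R <= N%:R * ln N%:R :> R.
Proof.
rewrite mulr_natl -[N in _ *+ N]subn0 -[in leRHS]subSS -sumr_const_nat.
rewrite big_nat [leRHS]big_nat; apply: ler_sum => n /andP[n0 nN].
by rewrite ler_ln ?posrE ?ltr0n ?ler_nat //; lia.
Qed.

Lemma sum_ln_ge N : N%:R * ln N%:R - N%:R <= \sum_(1 <= n < N.+1) ln n%:R :> R.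
Proof.
elim: N => [|N IHN]; first by rewrite big_geq // mul0r subrr.
rewrite big_nat_recr //=; case: (posnP N) => [->|N0].
  by rewrite big_geq // ln1 mulr0 add0r; lra.
have := ln_succ_le N0; set d := ln _ - _ => hd.
have : N%:R * d <= 1.
  by rewrite mulrC -ler_pdivlMr ?ltr0n // div1r.
by move: IHN; rewrite /d; move: (ln N.+1%:R) => L; rewrite -natr1; nra.
Qed.

(** The logarithm of the primorial bound; 3 comes from [ln 4 <= 4 - 1]. *)
Lemma sum_primes_ln_le N : \sum_(1 <= p < N.+1 | prime p) ln p%:R <= N%:R * 3 :> R.
Proof.
have -> : \sum_(1 <= p < N.+1 | prime p) ln p%:R = ln (\prod_(1 <= p < N.+1 | prime p) p)%N%:R :> R.
  (* Positivity is carried through the induction because [lnM] needs positive factors. *)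
  apply: (@proj2 (0 < (\prod_(1 <= p < N.+1 | prime p) p)%N)%N).
  apply: (big_rec2 (fun (x : R) (y : nat) => (0 < y)%N /\ x = ln y%:R)).
    by rewrite ln1.
  move=> p x y /prime_gt0 p0 [y0 ->]; split; first by rewrite muln_gt0 p0.
  by rewrite natrM lnM ?posrE ?ltr0n.
have P0 : (0 < \prod_(1 <= p < N.+1 | prime p) p)%N by apply: prodn_cond_gt0 => p /prime_gt0.
apply: (@le_trans _ _ (ln (4 ^ N)%N%:R)).
  by rewrite ler_ln ?posrE ?ltr0n ?expn_gt0 // ler_nat primorial_le.
rewrite natrX lnXn // -[ln _ *+ N]mulr_natl; apply: ler_wpM2l; first exact: ler0n.
by apply: le_trans (ln_le_pred _) _; lra.
Qed.

(** The logarithm as a divisor sum of the von Mangoldt function. The ranges depend on [N] only, so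
    that sums over [n] can be exchanged with them. *)
Lemma ln_prime_sum n N : (0 < n <= N)%N ->
  ln n%:R = \sum_(1 <= p < N.+1 | prime p) ln p%:R * \sum_(1 <= k < N.+1) (p ^ k %| n)%N%:R :> R.
Proof.
move=> /andP[n0 nN]; have := widen_partn predT nN; rewrite partnT // => {1}->.
transitivity (\sum_(0 <= p < N.+1 | p \in predT) ln p%:R * (logn p n)%:R : R).
  apply: (@proj2 (0 < (\prod_(0 <= p < N.+1 | p \in predT) p ^ logn p n)%N)%N).
  apply: (big_rec2 (fun (y : nat) (x : R) => (0 < y)%N /\ ln y%:R = x)).
    by rewrite ln1.
  move=> p x y _ [y0 <-]; split; first by rewrite muln_gt0 y0 andbT; case: (posnP p) => [->|]; [rewrite lognE|rewrite expn_gt0 => ->].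
  case: (posnP p) => [->|p0]; first by rewrite lognE /= expn0 mul1n mulr0 add0r.
  rewrite natrM lnM ?posrE ?ltr0n ?expn_gt0 ?p0 //; congr (_ + _).
  by rewrite natrX lnXn ?ltr0n // mulr_natr.
rewrite big_nat_recl //= ln0 // mul0r add0r big_add1 /= [RHS]big_mkcond /=.
rewrite !big_nat; apply: eq_bigr => p /andP[p0 pN]; case: ifP => pp; last first.
  by rewrite lognE pp /= mulr0.
congr (_ * _); rewrite logn_count_dvd // natr_sum.
rewrite [RHS](@big_cat_nat _ _ _ n) //=; last by rewrite ltnW.
rewrite [X in _ + X]big1_seq ?addr0 // => k /andP[_]; rewrite mem_index_iota => /andP[nk _].
rewrite gtnNdvd //; apply: leq_trans (ltn_expl k (prime_gt1 pp)); lia.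
Qed.

Lemma sum_dvdn (f : nat -> R) d N : (0 < d)%N ->
  \sum_(1 <= n < N.+1) (d %| n)%N%:R * f n = \sum_(1 <= m < (N %/ d)%N.+1) f (d * m)%N.
Proof.
move=> d0; elim: N => [|N IHN]; first by rewrite div0n !big_geq.
rewrite big_nat_recr //= IHN divnS //; case: (boolP (d %| N.+1)%N) => dN /=.
  rewrite mul1r add1n [RHS]big_nat_recr //=; congr (_ + f _).
  by rewrite -{1}(divnK dN) divnS // dN add1n mulnC.
by rewrite mul0r addr0 add0n.
Qed.

(** The common source of both Mertens estimates: [f = 1] gives the plain one, [f n = chi8 n / n] the
    twisted one. *)
Lemma sum_mul_ln (f : nat -> R) N :
  \sum_(1 <= n < N.+1) f n * ln n%:R =
  \sum_(1 <= p < N.+1 | prime p) ln p%:R *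
    \sum_(1 <= k < N.+1) \sum_(1 <= m < (N %/ p ^ k)%N.+1) f (p ^ k * m)%N.
Proof.
transitivity (\sum_(1 <= n < N.+1) \sum_(1 <= p < N.+1 | prime p) \sum_(1 <= k < N.+1)
   ln p%:R * ((p ^ k %| n)%N%:R * f n)).
  rewrite !big_nat; apply: eq_bigr => n /andP[n0 nN].
  rewrite (@ln_prime_sum n N) ?n0 // mulr_sumr; apply: eq_bigr => p _.
  rewrite !mulr_sumr; apply: eq_bigr => k _; lra.
rewrite exchange_big /=; apply: eq_bigr => p pp; rewrite exchange_big /= mulr_sumr.
apply: eq_bigr => k _; rewrite -mulr_sumr sum_dvdn // expn_gt0 prime_gt0 //.
Qed.

Lemma sum_inv_pow_le p K : (1 < p)%N ->
  \sum_(2 <= k < K) ((p ^ k)%N%:R)^-1 <= (p%:R * (p%:R - 1))^-1 :> R.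
Proof.
move=> p1; have p1r : 1 < p%:R :> R by rewrite ltr1n.
have [K2|/ltnW K2] := leqP K 2; first by rewrite big_geq // invr_ge0; nra.
(* The exact geometric sum, remainder included, is what induction can prove. *)
suff -> : \sum_(2 <= k < K) ((p ^ k)%N%:R)^-1 =
  (p%:R * (p%:R - 1))^-1 - (p%:R ^+ K.-1 * (p%:R - 1))^-1 :> R.
  by rewrite gerDl oppr_le0 invr_ge0 mulr_ge0 ?exprn_ge0 //; lra.
elim: K K2 => // K IHK; rewrite leq_eqVlt => /orP[/eqP <-|K2].
  by rewrite big_geq // expr1 subrr.
rewrite big_nat_recr //= IHK //; case: K K2 {IHK} => //= K K2.
rewrite natrX exprS !invfM.
have hx : p%:R^-1 * p%:R = 1 :> R by rewrite mulVf // gt_eqF //; lra.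
have hj : (p%:R - 1)^-1 * (p%:R - 1) = 1 :> R by rewrite mulVf // gt_eqF //; lra.
move: (p%:R ^- K) p%:R^-1 (p%:R - 1)^-1 hx hj => i h j hx hj.
have : i * j * (h * p%:R) = i * j by rewrite hx mulr1.
have : h * i * (j * (p%:R - 1)) = h * i by rewrite hj mulr1.
lra.
Qed.

(** Controls the total contribution of the prime powers [p ^ k] with [k >= 2]. *)
Lemma sum_ln_prime_sq N :
  \sum_(1 <= p < N.+1 | prime p) ln p%:R * (p%:R * (p%:R - 1))^-1 <= 2 :> R.
Proof.
apply: (@le_trans _ _ (\sum_(2 <= n < N.+1) ln n%:R * (n%:R * (n%:R - 1))^-1)).
  rewrite big_mkcond /=; case: N => [|N]; first by rewrite !big_geq //.
  rewrite big_ltn //= add0r [leLHS]big_nat [leRHS]big_nat; apply: ler_sum => p /andP[p2 _].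
  case: ifP => // _; rewrite mulr_ge0 ?ln_nat_ge0 // invr_ge0 mulr_ge0 // subr_ge0 ler1n; lia.
case: N => [|N]; first by rewrite big_geq.
(* [(ln n + 2) / n] has differences dominating the summand. *)
suff : \sum_(2 <= n < N.+2) ln n%:R * (n%:R * (n%:R - 1))^-1 <= 2 - (ln N.+1%:R + 2) * N.+1%:R^-1 :> R.
  by move=> /le_trans; apply; rewrite gerBl mulr_ge0 ?invr_ge0 // addr_ge0 // ln_nat_ge0.
elim: N => [|N IHN]; first by rewrite big_geq // ln1; lra.
rewrite big_nat_recr //=; have := @ln_succ_le N.+1 isT.
move: IHN; set S := \sum_(_ <= i < _) _; set u := ln N.+1%:R; set v := ln N.+2%:R.
have x0 : 1 <= N.+1%:R :> R by rewrite ler1n.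
rewrite -(natr1 N.+1); move: x0; set x : R := N.+1%:R => x0 IHN h.
have h' : (v - u) * x <= 1 by rewrite -ler_pdivlMr ?div1r //; lra.
have E : 2 - (u + 2) * x^-1 + v * ((x + 1) * (x + 1 - 1))^-1 - (2 - (v + 2) * (x + 1)^-1) =
   ((v - u) * (x + 1) - 2) * (x * (x + 1))^-1.
  rewrite addrK !invfM.
  have hx : x^-1 * x = 1 by rewrite mulVf // gt_eqF //; lra.
  have hk : (x + 1)^-1 * (x + 1) = 1 by rewrite mulVf // gt_eqF //; lra.
  move: x^-1 (x + 1)^-1 hx hk => h1 k hx hk.
  have := congr1 ( *%R (v * k)) hx; have := congr1 ( *%R (u * h1)) hk.
  by have := congr1 ( *%R k) hx; have := congr1 ( *%R h1) hk; have := congr1 ( *%R (u * k)) hx; lra.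
have : ((v - u) * (x + 1) - 2) * (x * (x + 1))^-1 <= 0.
  by rewrite mulr_le0_ge0 ?invr_ge0; nra.
by rewrite -E subr_le0 => H; apply: le_trans H; rewrite lerD2r.
Qed.

(** Mertens' first theorem. Rounding [N / p ^ k] up to its real value and bounding higher powers by
    2 gives one side; keeping only [k = 1] and losing less than 1 per prime gives the other. *)
Lemma sum_ln_primes_bounds N : (0 < N)%N ->
  `|\sum_(1 <= p < N.+1 | prime p) ln p%:R / p%:R - ln N%:R| <= 3 :> R.
Proof.
move=> N0; have N0r : 0 < N%:R :> R by rewrite ltr0n.
have := @sum_mul_ln (fun=> 1) N; under eq_bigr do rewrite mul1r.
have E p : \sum_(1 <= k < N.+1) \sum_(1 <= m < (N %/ p ^ k)%N.+1) (1 : R) = \sum_(1 <= k < N.+1) (N %/ p ^ k)%N%:R.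
  by apply: eq_bigr => k _; rewrite sumr_const_nat subSS subn0.
under [in X in _ = X]eq_bigr do rewrite E.
move=> L.
set S := \sum_(1 <= p < N.+1 | prime p) _.
have up : \sum_(1 <= n < N.+1) ln n%:R <= N%:R * (S + 2) :> R.
  rewrite L; apply: (@le_trans _ _ (N%:R * (S + \sum_(1 <= p < N.+1 | prime p) ln p%:R * (p%:R * (p%:R - 1))^-1))); last first.
    by apply: ler_wpM2l; [rewrite ltW|rewrite lerD2l sum_ln_prime_sq].
  rewrite -big_split /= mulr_sumr; apply: ler_sum => p pp.
  rewrite -mulrDr mulrCA; apply: ler_wpM2l; first exact: ln_nat_ge0.
  rewrite big_ltn //= expn1 mulrDr; apply: lerD.
    by rewrite ler_pdivlMr ?ltr0n ?prime_gt0 // -natrM ler_nat leq_trunc_div.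
  apply: (@le_trans _ _ (N%:R * \sum_(2 <= k < N.+1) ((p ^ k)%N%:R)^-1)).
    rewrite mulr_sumr; apply: ler_sum => k _.
    by rewrite ler_pdivlMr ?ltr0n ?expn_gt0 ?prime_gt0 // -natrM ler_nat leq_trunc_div.
  by apply: ler_wpM2l; [rewrite ltW|rewrite sum_inv_pow_le ?prime_gt1].
have lo : N%:R * S - N%:R * 3 <= \sum_(1 <= n < N.+1) ln n%:R.
  rewrite L; apply: (@le_trans _ _ (N%:R * S - \sum_(1 <= p < N.+1 | prime p) ln p%:R)).
    by rewrite lerD2l lerN2 sum_primes_ln_le.
  rewrite mulr_sumr -sumrB; apply: ler_sum => p pp.
  rewrite big_ltn //= expn1 mulrCA -[X in _ - X]mulr1 -mulrBr; apply: ler_wpM2l; first exact: ln_nat_ge0.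
  apply: ler_wpDr; first by apply: sumr_ge0.
  rewrite lerBlDr natr1 ltW // ltr_pdivrMr ?ltr0n ?prime_gt0 // -natrM ltr_nat ltn_ceil ?prime_gt0 //.
have := sum_ln_le N; have := sum_ln_ge N => h1 h2.
by rewrite ler_norml; apply/andP; split; nra.
Qed.

(** The quotient decreases once [ln n >= 1]. Starting at 8 makes this easy: [ln 2 >= 1 / 2], hence
    [ln 8 >= 3 / 2]. *)
Lemma ln_div_nonincreasing n : (8 <= n)%N ->
  ln n.+1%:R / n.+1%:R <= ln n%:R / n%:R :> R.
Proof.
move=> n8; have n0 : 0 < n%:R :> R by rewrite ltr0n; lia.
rewrite ler_pdivrMr ?ltr0n // mulrAC ler_pdivlMr //.
have l1 : 1 <= ln n%:R :> R.
  apply: (@le_trans _ _ (ln (2 ^ 3)%N%:R)); last first.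
    by rewrite ler_ln ?posrE ?ltr0n ?ler_nat //; lia.
  have := @ln_le_pred 2^-1; rewrite lnV ?posrE // natrX lnXn // -[ln _ *+ 3]mulr_natl; lra.
have := @ln_succ_le n ltac:(lia); set v := ln _; set u := ln n%:R in l1 *.
rewrite -div1r ler_pdivlMr // -(natr1 n); nra.
Qed.

(** The first seven terms are at most 1 each in absolute value; the tail from 8 contributes at most
    2 by Abel summation. *)
Lemma normr_sum_chi8_ln_le N : `|\sum_(1 <= n < N.+1) chi8 n / n%:R * ln n%:R| <= 9.
Proof.
have t n : `|chi8 n / n%:R * ln n%:R| <= 1.
  case: n => [|n]; first by rewrite ln0 // mulr0 normr0.
  rewrite -mulrA normrM mulr_ile1 ?normr_chi8_le1 // ger0_norm ?mulr_ge0 ?invr_ge0 ?ln_nat_ge0 //.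
  by rewrite mulrC ler_pdivrMr ?ltr0n // mul1r (le_trans (ln_le_pred _)) ?ltr0n // gerBl.
have s M : (M < 8)%N -> `|\sum_(1 <= n < M.+1) chi8 n / n%:R * ln n%:R| <= 7.
  move=> M8; apply: le_trans (ler_norm_sum _ _ _) _.
  apply: (@le_trans _ _ (\sum_(1 <= n < M.+1) 1)); first exact: ler_sum.
  by rewrite sumr_const_nat subSS subn0 ler_nat.
have [N8|N8] := ltnP N 8; first by apply: le_trans (s N N8) _; rewrite ler_nat.
rewrite (@big_cat_nat _ _ _ 8) //=; last by lia.
apply: le_trans (ler_normD _ _) _; have := s 7%N isT.
have : `|\sum_(8 <= n < N.+1) chi8 n * (ln n%:R / n%:R)| <= 2 * (ln 8%:R / 8%:R).
  apply: (@chi8_sum_tail (fun n => ln n%:R / n%:R)) => n n8; last exact: ln_div_nonincreasing.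
  by rewrite divr_ge0 ?ln_nat_ge0.
have -> : \sum_(8 <= n < N.+1) chi8 n * (ln n%:R / n%:R) = \sum_(8 <= n < N.+1) chi8 n / n%:R * ln n%:R.
  by apply: eq_bigr => n _; rewrite mulrA mulrAC.
have : ln 8%:R / 8%:R <= 1 :> R.
  by rewrite ler_pdivrMr ?ltr0n // mul1r (le_trans (ln_le_pred _)) ?ltr0n // gerBl.
lra.
Qed.

(** Expanding [ln n] over prime powers gives [chi8_harmonic N * S] up to an error of 10: replacing
    [chi8_harmonic (N %/ p)] by [chi8_harmonic N] costs at most 6 by Chebyshev, and the higher
    powers cost at most 4. *)
Lemma sum_chi8_primes_bound N : (0 < N)%N ->
  `|\sum_(1 <= p < N.+1 | prime p) chi8 p * (ln p%:R / p%:R)| <= 57.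
Proof.
move=> N0; have N0r : 0 < N%:R :> R by rewrite ltr0n.
set S := \sum_(1 <= p < N.+1 | prime p) _.
have := normr_sum_chi8_ln_le N; rewrite (sum_mul_ln (fun n => chi8 n / n%:R)).
have E p : \sum_(1 <= k < N.+1) \sum_(1 <= m < (N %/ p ^ k)%N.+1) chi8 (p ^ k * m) / (p ^ k * m)%N%:R
   = \sum_(1 <= k < N.+1) chi8 (p ^ k) / (p ^ k)%N%:R * chi8_harmonic (N %/ p ^ k).
  apply: eq_bigr => k _; rewrite /chi8_harmonic mulr_sumr; apply: eq_bigr => m _.
  by rewrite chi8M natrM invfM mulrACA.
under eq_bigr do rewrite E.
set L := \sum_(1 <= p < N.+1 | prime p) _ => hL.
have hD : `|L - chi8_harmonic N * S| <= 10.
  apply: (@le_trans _ _ (2 / N%:R * \sum_(1 <= p < N.+1 | prime p) ln p%:R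
     + 2 * \sum_(1 <= p < N.+1 | prime p) ln p%:R * (p%:R * (p%:R - 1))^-1)); last first.
    have := sum_ln_prime_sq N; have := sum_primes_ln_le N => h1 h2.
    have : 2 / N%:R * \sum_(1 <= p < N.+1 | prime p) ln p%:R <= 6 :> R.
      rewrite mulrAC ler_pdivrMr //; lra.
    lra.
  rewrite /L /S !mulr_sumr -sumrB -big_split /=.
  apply: le_trans (ler_norm_sum _ _ _) _; apply: ler_sum => p pp.
  have p0 : 0 < p%:R :> R by rewrite ltr0n prime_gt0.
  rewrite big_ltn //= expn1.
  set T := \sum_(2 <= k < _) _.
  have -> : ln p%:R * (chi8 p / p%:R * chi8_harmonic (N %/ p) + T) - chi8_harmonic N * (chi8 p * (ln p%:R / p%:R))
     = ln p%:R * (chi8 p / p%:R * (chi8_harmonic (N %/ p) - chi8_harmonic N) + T).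
    lra.
  rewrite normrM ger0_norm ?ln_nat_ge0 // [X in _ <= X + _]mulrC [X in _ <= _ + X]mulrCA -mulrDr.
  apply: ler_wpM2l; first exact: ln_nat_ge0.
  apply: le_trans (ler_normD _ _) _; apply: lerD.
    rewrite normrM distrC.
    have := chi8_harmonic_diff (leq_div N p).
    set y := `|chi8_harmonic _ - _| => hy.
    have c1 : `|chi8 p / p%:R| <= p%:R^-1.
      by rewrite normrM (@ger0_norm _ p%:R^-1) ?invr_ge0 // ler_piMl ?invr_ge0 // normr_chi8_le1.
    have c2 : N%:R <= p%:R * (N %/ p)%N.+1%:R :> R.
      by rewrite -natrM ler_nat mulnC ltnW // ltn_ceil // prime_gt0.
    apply: (@le_trans _ _ (p%:R^-1 * (2 * (N %/ p)%N.+1%:R^-1))).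
      by apply: ler_pM => //; rewrite normr_ge0.
    rewrite mulrCA -invfM; apply: ler_wpM2l => //.
    by rewrite lef_pV2 ?posrE // mulr_gt0 // ltr0n.
  apply: le_trans (ler_norm_sum _ _ _) _.
  apply: (@le_trans _ _ (2 * \sum_(2 <= k < N.+1) ((p ^ k)%N%:R)^-1)); last first.
    by apply: ler_wpM2l => //; rewrite sum_inv_pow_le ?prime_gt1.
  rewrite mulr_sumr; apply: ler_sum => k _.
  rewrite normrM mulrC; apply: ler_pM => //; first exact: chi8_harmonic_le.
  by rewrite normrM (@ger0_norm _ (_^-1)) ?invr_ge0 // ler_piMl ?invr_ge0 // normr_chi8_le1.
(* The product [chi8_harmonic N * S] is at most 9 + 10 in absolute value, and its first factor is at
   least 1/3. *)
have := chi8_harmonic_ge N0; move: hL hD; rewrite !ler_norml.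
by move=> /andP[? ?] /andP[? ?] ?; apply/andP; split; nra.
Qed.

(** * Lower bound for the number of good primes *)

Lemma good_prime_tail M N : (2 <= M <= N)%N ->
  \sum_(M.+1 <= p < N.+1 | prime p) (1 + chi8 p) * (ln p%:R / p%:R) <=
  (count good_prime (index_iota 1 N.+1))%:R * (2 * ln N%:R / M.+1%:R) :> R.
Proof.
move=> /andP[M2 MN].
have pos n : 0 <= (2 * ln N%:R / n%:R) :> R by rewrite divr_ge0 // mulr_ge0 // ln_nat_ge0.
apply: (@le_trans _ _ (\sum_(M.+1 <= p < N.+1 | good_prime p) 2 * ln N%:R / M.+1%:R)).
  rewrite big_mkcond [leRHS]big_mkcond big_nat [leRHS]big_nat /=.
  apply: ler_sum => p /andP[Mp pN]; rewrite /good_prime /chi8; case: (boolP (prime p)) => pp //=.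
  case: ifP => h8.
    rewrite -mulrA; apply: ler_pM => //; first by rewrite divr_ge0 ?ln_nat_ge0.
    apply: ler_pM; rewrite ?ln_nat_ge0 ?invr_ge0 //.
      by rewrite ler_ln ?posrE ?ltr0n ?ler_nat //; lia.
    by rewrite lef_pV2 ?posrE ?ltr0n ?ler_nat //; lia.
  (* The remaining primes have weight 0: since [M >= 2], the prime 2 is outside the range. *)
  suff -> : ((p %% 8 == 3) || (p %% 8 == 5))%N = true by rewrite subrr mul0r.
  by have := even_prime pp; lia.
have := pos M.+1; set c := _ / _ => c0.
have -> : (count good_prime (index_iota 1 N.+1))%:R * c = \sum_(1 <= p < N.+1 | good_prime p) c.
  by rewrite big_const_seq iter_addr addr0 mulr_natl.
by rewrite [leRHS](@big_cat_nat _ _ _ M.+1) //=; apply: ler_wpDl => //; apply: sumr_ge0.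
Qed.

Lemma count_good_prime_ge : exists (c : R) (N0 : nat),
  [/\ 0 < c, (2 <= N0)%N & forall N, (N0 <= N)%N ->
  c * (N%:R / ln N%:R) <= (count good_prime (index_iota 1 N.+1))%:R].
Proof.
(* Each of [A N] and [A M] has error at most 60 = 57 + 3, so [ln D >= 121] leaves a difference of at
   least 1. *)
have [D lD] : exists D : nat, 121 <= ln D%:R :> R.
  exists (Num.trunc (expR 121 : R)).+1; rewrite -[leLHS](@expRK R) ler_ln ?posrE ?expR_gt0 //.
  exact/ltW/truncnS_gt.
have D1 : (1 < D)%N.
  by case: D lD => [|[|//]]; rewrite ?ln1 ?ln0 //; lra.
have D0 : 0 < D%:R :> R by rewrite ltr0n; apply: ltnW.
(* From [1 <= k * 2 ln N / (M + 1)] and [N <= D (M + 1)] one gets [k >= N / (2 D ln N)]; [N >= 2 D]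
   ensures [M >= 2]. *)
exists ((2 * D%:R)^-1), (D * 2)%N; split; [by rewrite invr_gt0 mulr_gt0|by lia|].
move=> N DN.
pose M := (N %/ D)%N.
have M2 : (2 <= M)%N by rewrite /M leq_divRL 1?mulnC // ltnW.
have MN : (M <= N)%N by exact: leq_div.
have N2 : (2 <= N)%N by exact: leq_trans MN.
pose A K : R := \sum_(1 <= p < K.+1 | prime p) (1 + chi8 p) * (ln p%:R / p%:R).
have hA K : (0 < K)%N -> `|A K - ln K%:R| <= 60.
  move=> K0; have := sum_ln_primes_bounds K0; have := sum_chi8_primes_bound K0.
  have -> : A K = \sum_(1 <= p < K.+1 | prime p) ln p%:R / p%:R +
     \sum_(1 <= p < K.+1 | prime p) chi8 p * (ln p%:R / p%:R).
    by rewrite -big_split /=; apply: eq_bigr => p _; rewrite mulrDl mul1r.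
  by rewrite !ler_norml; lra.
have M0 : (0 < M)%N by exact: ltnW.
have N0 : (0 < N)%N by exact: ltnW.
have hN := hA N N0; have hM := hA M M0.
have AMN : A N = A M + \sum_(M.+1 <= p < N.+1 | prime p) (1 + chi8 p) * (ln p%:R / p%:R).
  by rewrite /A (@big_cat_nat _ _ _ M.+1).
have := @good_prime_tail M N; rewrite M2 MN => /(_ isT).
set S := \sum_(_ <= _ < _ | _) _ in AMN *; set k : R := _%:R => hS.
have lMN : ln D%:R + ln M%:R <= ln N%:R :> R.
  rewrite -lnM ?posrE ?ltr0n ?(ltnW D1) //.
  by rewrite -natrM ler_ln ?posrE ?ltr0n ?muln_gt0 ?M0 ?(ltnW D1) // ler_nat mulnC leq_trunc_div.
have S1 : 1 <= S by move: hN hM; rewrite !ler_norml AMN; lra.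
have k0 : 0 <= k by exact: ler0n.
have l0 : 0 < ln N%:R :> R by rewrite ln_gt0 // ltr1n.
have M1 : 0 < M.+1%:R :> R by rewrite ltr0n.
have ND : N%:R <= D%:R * M.+1%:R :> R.
  by rewrite -natrM ler_nat mulnC ltnW // ltn_ceil // ltnW.
have : 1 <= k * (2 * ln N%:R / M.+1%:R) by exact: le_trans hS.
rewrite mulrA ler_pdivlMr // mul1r => h.
rewrite mulrA ler_pdivrMr // ler_pdivrMl ?mulr_gt0 //.
by apply: le_trans ND _; nra.
Qed.
End Chebyshev.

Local Open Scope classical_set_scope.

(** * The Beurling integers *)

Lemma unbounded_nat_enum (A : set nat) : (forall n, exists2 m, (n <= m)%N & A m) ->
  exists u : nat -> nat, (forall i, u i < u i.+1)%N /\ range u = A.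
Proof.
move=> unbA.
have exA n : exists m, (n <= m)%N && `[< A m >].
  by have [m nm Am] := unbA n; exists m; rewrite nm; apply/asboolP.
pose nxt n := ex_minn (exA n).
have nxtP n : [/\ (n <= nxt n)%N, A (nxt n) & forall m, (n <= m)%N -> A m -> (nxt n <= m)%N].
  rewrite /nxt; case: ex_minnP => m /andP[nm /asboolP Am] h; split => // k nk Ak.
  by apply: h; rewrite nk; apply/asboolP.
pose u := fix u i := if i is j.+1 then nxt (u j).+1 else nxt 0%N.
have uS i : (u i < u i.+1)%N by have [] := nxtP (u i).+1.
have ge_u i : (i <= u i)%N by elim: i => // i IHi; apply: leq_ltn_trans IHi (uS i).
exists u; split => //; apply/seteqP; split => [_ [i _ <-]|m Am].
  by case: i => [|i]; [have [] := nxtP 0%N|have [] := nxtP (u i).+1].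
have ex_u : exists i, (m <= u i)%N by exists m.
case: (ex_minnP ex_u) => i mi h; exists i => //; apply/eqP; rewrite eqn_leq mi andbT.
case: i mi h => [|i] mi h; first by have [_ _] := nxtP 0%N; apply.
have [_ _] := nxtP (u i).+1; apply => //; rewrite ltnNge; apply/negP => /h; lia.
Qed.

(** Values at distance at least 1 have distinct integer parts, so enumerating these in increasing
    order lists the elements by increasing value. *)
Lemma separated_enum (R : realType) (T : Type) (A : set T) (v : T -> R) :
  (forall x, A x -> 0 <= v x) ->
  (forall x y, A x -> A y -> x <> y -> 1 <= `|v x - v y|) ->
  (forall n : nat, exists2 x, A x & n%:R <= v x) ->
  exists e : nat -> T, set_bij setT A e /\ forall i, 1 <= v (e i.+1) - v (e i).
Proof.
move=> v0 sep unb; pose k x := Num.trunc (v x).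
have kP x : A x -> (k x)%:R <= v x < (k x).+1%:R by move=> /v0/truncn_itv.
have k_inj x y : A x -> A y -> k x = k y -> x = y.
  move=> Ax Ay kxy; apply: contrapT => /(sep _ _ Ax Ay).
  by have := kP x Ax; have := kP y Ay; rewrite -kxy -(natr1 (k x)) ler_normr; lra.
have [n|u [uS ru]] := @unbounded_nat_enum (k @` A).
  have [x Ax nx] := unb n; exists (k x); last by exists x.
  by rewrite truncn_ge_nat // v0.
have [e eP] : {e : nat -> T & forall i, A (e i) /\ k (e i) = u i}.
  apply: (@choice _ _ (fun i x => A x /\ k x = u i)) => i; have : range u (u i) by exists i.
  by rewrite ru => -[x Ax kx]; exists x.
have u_lt : {homo u : i j / (i < j)%N} by exact: homo_ltn ltn_trans uS.
exists e; split.
  split.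
  - by move=> i _; have [] := eP i.
  - move=> i j _ _ eij; have : u i = u j by have [_ <-] := eP i; have [_ <-] := eP j; rewrite eij.
    by case: (ltngtP i j) => // /u_lt; lia.
  - move=> x Ax; have : (k @` A) (k x) by exists x.
    rewrite -ru => -[i _ ui]; exists i => //; have [Ae ke] := eP i.
    by apply: k_inj => //; rewrite ke.
move=> i; have [Ai ki] := eP i; have [Aj kj] := eP i.+1.
have ne : e i.+1 <> e i by move=> eq; have := uS i; rewrite -ki -kj eq ltnn.
have := sep _ _ Aj Ai ne.
have : (k (e i)).+1%:R <= (k (e i.+1))%:R :> R by rewrite ler_nat ki kj.
by have := kP _ Ai; have := kP _ Aj; rewrite ler_normr; lra.
Qed.

(** * Freeness, gaps and counting for the generators *)

Section Generators.
Variable R : realType.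
Variables (g : nat -> R) (nu : nat -> nat).
Hypothesis gP : forall p, good_prime p ->
  [/\ quad_rep (g p) (nu p), nu p = p \/ nu p = (2 * p)%N & p%:R < g p < (8 * p)%:R].

Let G : set R := [set x | exists2 p, good_prime p & x = g p].

Lemma good_prime_ge7 p : good_prime p -> (7 <= p)%N.
Proof. by case/andP=> /prime_gt1 p1 /orP[] /eqP; lia. Qed.

(** A possible factor 2 in the norm is invisible to [p], which is at least 7. *)
Lemma logn_nu p q : good_prime p -> good_prime q -> logn p (nu q) = (p == q).
Proof.
move=> gp gq; have [pp _] := andP gp; have [pq _] := andP gq.
have [_ + _] := gP gq; case=> ->; first by rewrite logn_prime // eq_sym.
rewrite lognM ?prime_gt0 // !logn_prime // gtn_eqF ?add0n //.
all: have := good_prime_ge7 gp; lia.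
Qed.

Lemma gen_inj p q : good_prime p -> good_prime q -> (g p == g q) = (p == q).
Proof.
move=> gp gq; apply/eqP/eqP => [gpq|-> //].
have [rp _ _] := gP gp; have [rq _ _] := gP gq.
have := logn_nu gp gq; rewrite gpq in rp; rewrite -(quad_rep_inj rp rq) logn_nu // eqxx.
by case: eqP.
Qed.

Lemma nu_gt0 p : good_prime p -> (0 < nu p)%N.
Proof. by move=> gp; have := good_prime_ge7 gp; have [_ [] -> _] := gP gp; lia. Qed.

(** The empty product is excluded because 1 is its own conjugate and violates the bound 1/2. *)
Lemma quad_rep_prod (s : seq R) : {in s, forall x, G x} -> s != [::] ->
  exists m, [/\ quad_rep (\prod_(x <- s) x) m, (0 < m)%N &
    forall p, good_prime p -> logn p m = count_mem (g p) s].
Proof.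
elim: s => // x s IHs sG _.
have [q gq xq] : G x by apply: sG; rewrite inE eqxx.
have [rq _ _] := gP gq.
have [->|s0] := eqVneq s [::].
  exists (nu q); rewrite big_seq1 xq; split => //; first exact: nu_gt0.
  by move=> p gp; rewrite logn_nu //= gen_inj // addn0 eq_sym.
have [m [rm m0 lm]] := IHs (fun y ys => sG y (mem_behead (s := x :: s) ys)) s0.
exists (nu q * m)%N; rewrite big_cons xq; split; first exact: quad_rep_mul.
  by rewrite muln_gt0 nu_gt0.
by move=> p gp; rewrite lognM ?nu_gt0 // logn_nu // lm //= gen_inj // eq_sym.
Qed.

Lemma gen_ge7 x : G x -> 7 <= x.
Proof.
move=> [p gp ->]; have [_ _ /andP[/ltW + _]] := gP gp; apply: le_trans.
by rewrite (ler_nat _ 7) good_prime_ge7.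
Qed.

Lemma prod_gen_ge (s : seq R) : {in s, forall x, G x} -> (7 ^+ size s) <= \prod_(x <- s) x.
Proof.
elim: s => [|x s IHs] sG; first by rewrite big_nil.
rewrite big_cons exprS; apply: ler_pM => //.
- by apply: gen_ge7; apply: sG; rewrite inE eqxx.
- by apply: IHs => y ys; apply: sG; rewrite inE ys orbT.
Qed.

(** The empty product 1 is treated apart, every other product being at least 7. For nonempty ones,
    equal products have equal norms, whose valuations recover all multiplicities. *)
Lemma prod_gen_gap (m1 m2 : {mset R}%mset) : gen_multisets G m1 -> gen_multisets G m2 ->
  m1 <> m2 -> 1 <= `|\prod_(x <- m1) x - \prod_(x <- m2) x|.
Proof.
move=> G1 G2 ne.
have far (s : seq R) : {in s, forall x, G x} -> s != [::] -> 1 <= `|\prod_(x <- s) x - 1|.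
  case: s => // x s /prod_gen_ge + _; rewrite ler_normr /= exprS.
  have : 1 <= 7 ^+ size s :> R by rewrite exprn_ege1 // ler1n.
  lra.
have [m10|m10] := eqVneq (m1 : seq R) [::]; have [m20|m20] := eqVneq (m2 : seq R) [::].
- by case: ne; rewrite -(seq_mset_id m1) -(seq_mset_id m2) m10 m20.
- by rewrite m10 big_nil distrC far.
- by rewrite m20 big_nil far.
have [n1 [r1 _ l1]] := quad_rep_prod G1 m10.
have [n2 [r2 _ l2]] := quad_rep_prod G2 m20.
apply: (quad_rep_gap r1 r2); apply/eqP => eq12; case: ne.
rewrite eq12 in r1; have n12 := quad_rep_inj r1 r2.
apply/msetP => x; case: (pselect (G x)) => [[p gp ->]|nGx].
  by rewrite -!count_mem_mset -l1 // -l2 // n12.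
by rewrite (mset_eq0P _) 1?(mset_eq0P _) //; apply/negP => /[dup]; [move/G2|move/G1].
Qed.

Lemma gen_count_ge (x : R) (N : nat) : (8 * N)%:R <= x ->
  (count good_prime (index_iota 1 N.+1) <= gen_count G x)%N.
Proof.
move=> Nx; rewrite /gen_count.
(* Finiteness keeps [fset_set] from defaulting to the empty set; it follows from [p < g p <= x]. *)
have fin : finite_set [set y | G y /\ y <= x].
  apply: (@sub_finite_set _ _ (g @` `I_(Num.trunc x).+1)); last exact/finite_image/finite_II.
  move=> _ [[p gp ->] gx]; exists p => //=; rewrite ltnS.
  have [_ _ /andP[+ _]] := gP gp => pg; have px := ltW (lt_le_trans pg gx).
  by rewrite truncn_ge_nat // (le_trans _ px).
rewrite -size_filter -(size_map g); apply: uniq_leq_size.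
  rewrite map_inj_in_uniq ?filter_uniq ?iota_uniq // => p q.
  by rewrite !mem_filter => /andP[gp _] /andP[gq _] /eqP; rewrite gen_inj // => /eqP.
move=> y /mapP[p]; rewrite mem_filter mem_index_iota => /andP[gp /andP[_ pN]] ->.
rewrite in_fset_set //; apply: mem_set; split; first by exists p.
have [_ _ /andP[_ /ltW gp8]] := gP gp; apply: le_trans gp8 _; apply: le_trans Nx.
by rewrite ler_nat leq_mul2l.
Qed.

Lemma gen_count_near : exists2 c : R, 0 < c &
  \forall x \near +oo%R, c * (x / ln x) < (gen_count G x)%:R.
Proof.
have [c [N0 [c0 N02 hc]]] := count_good_prime_ge R.
(* For [x >= 16], the integer part [N] of [x / 8] is at least [x / 16]; another factor 2 makes the
   inequality strict. *)
exists (c / 32); first by rewrite divr_gt0.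
near=> x.
have x16 : 16 <= x by near: x; apply: nbhs_pinfty_ge; rewrite num_real.
have xN0 : 8 * N0%:R <= x by near: x; apply: nbhs_pinfty_ge; rewrite num_real.
pose N := Num.trunc (x / 8).
have x80 : 0 <= x / 8 by lra.
have /andP[Nx xN] : N%:R <= x / 8 < N.+1%:R := truncn_itv x80.
have NN0 : (N0 <= N)%N by rewrite truncn_ge_nat //; lra.
have N2 : (2 <= N)%N by exact: leq_trans NN0.
apply: lt_le_trans (_ : (count good_prime (index_iota 1 N.+1))%:R <= _); last first.
  by rewrite ler_nat; apply: gen_count_ge; rewrite natrM; lra.
apply: lt_le_trans (hc N NN0).
have l0 : 0 < ln N%:R :> R by rewrite ln_gt0 // ltr1n.
have lx : ln N%:R <= ln x.
  have : 0 < N%:R :> R by rewrite ltr0n ltnW.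
  by move=> ?; rewrite ler_ln ?posrE; lra.
have NX : x / 16 <= N%:R by rewrite -(natr1 N) in xN; lra.
have lx0 : 0 < ln x by exact: lt_le_trans lx.
rewrite -mulrA ltr_pM2l // mulrA ltr_pdivrMr //.
rewrite mulrAC ltr_pdivlMr //; nra.
Unshelve. all: by end_near.
Qed.

Lemma gen_beurling : exists b : nat -> R,
  beurling_integers G b /\ forall i : nat, 1 <= b i.+1 - b i.
Proof.
have [||n|e [be gap]] := @separated_enum R _ (gen_multisets G) (fun m => \prod_(x <- m) x).
- by move=> m /prod_gen_ge; apply: le_trans; rewrite exprn_ge0.
- exact: prod_gen_gap.
(* Powers of the generator attached to 7 show that the products are unbounded. *)
- have g7 : good_prime 7 by []; exists (msetn n (g 7)).
    by move=> x; rewrite in_msetn => /andP[_ /eqP ->]; exists 7.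
  have : {in msetn n (g 7), forall x, G x}.
    by move=> x; rewrite in_msetn => /andP[_ /eqP ->]; exists 7.
  by move=> /prod_gen_ge; apply: le_trans; rewrite enum_msetn size_nseq -natrX ler_nat ltnW // ltn_expl.
exists (fun i => \prod_(x <- e i) x); split => //; split.
  by move=> i; have := gap i; lra.
by exists e.
Qed.
End Generators.

Theorem theorem6 (R : realType) :
  exists (G : set R) (c : R),
    [/\ (forall g : R, G g -> irrational g /\ 1 < g),
        0 < c,
        (\forall x \near +oo%R, c * (x / ln x) < (gen_count G x)%:R) &
        exists b : nat -> R,
          beurling_integers G b /\ forall i : nat, 1 <= b i.+1 - b i].
Proof.
have [f fP] : {f : nat -> R * nat & forall p, good_prime p ->
    [/\ quad_rep (f p).1 (f p).2, (f p).2 = p \/ (f p).2 = (2 * p)%N & p%:R < (f p).1 < (8 * p)%:R]}.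
  apply: (@choice _ _ (fun p y => good_prime p -> [/\ quad_rep y.1 y.2, y.2 = p \/ y.2 = (2 * p)%N & p%:R < y.1 < (8 * p)%:R])) => p.
  (* Outside the good primes the choice takes a default value, about which nothing is claimed. *)
  case: (boolP (good_prime p)) => [gp|_]; last by exists (0, 0%N).
  have /andP[pp /orP h8] := gp.
  have [|x [n h]] := @generator_exists R p pp; last by exists (x, n).
  by case: h8 => /eqP; [left|right].
have [c c0 hc] := gen_count_near (g := fun p => (f p).1) fP.
exists [set x | exists2 p, good_prime p & x = (f p).1], c; split => //.
  move=> x Gx; have x7 := gen_ge7 (g := fun p => (f p).1) fP Gx; split; last by lra.
  by case: Gx x7 => p /fP[rp _ _] -> x7; apply: quad_rep_irrational rp _; lra.
exact: (gen_beurling (g := fun p => (f p).1) fP).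
Qed.
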